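(* Let $R$ be a filtered ring with a filtration $R_0\subseteq R_1\subseteq R_2\subseteq\cdots$ such that $R_0\setminus\{0\}\subseteq R^\times$ and such that the associated graded ring $\operatorname{gr}R$ is a domain. Then $R$ is a BF-domain.
   Context: Rings are associative with identity; domains need not be commutative. A filtration of $R$ is an ascending chain of additive subgroups $R_0\subseteq R_1\subseteq\cdots$ with $1\in R_0$, $R_iR_j\subseteq R_{i+j}$ and $\bigcup_i R_i=R$; the associated graded ring is $\operatorname{gr}R=\bigoplus_{i\ge 0}R_i/R_{i-1}$ with $R_{-1}=0$. $R^\times$ is the group of units of $R$, and $R^\bullet$ is the multiplicative monoid of cancellative elements (neither left nor right zero-divisors). A nonunit $u\in R^\bullet$ is an atom if $u=ab$ with $a,b\in R^\bullet$ implies that $a$ or $b$ is a unit. $R$ is a BF-ring if every nonunit of $R^\bullet$ is a finite product of atoms of $R^\bullet$ and for every $a\in R^\bullet$ there is $\lambda(a)\in\mathbb{Z}_{\ge 0}$ such that $k\le\lambda(a)$ whenever $a=u_1\cdots u_k$ with atoms $u_i$ of $R^\bullet$. A BF-domain is a domain that is a BF-ring. *)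

(* Defs.v *)
From HB Require Import structures.
From mathcomp Require Import all_boot all_algebra.
From mathcomp Require Import ring_quotient boolp.

Set Implicit Arguments.
Unset Strict Implicit.
Unset Printing Implicit Defensive.

Import GRing.Theory.
Local Open Scope ring_scope.
Local Open Scope quotient_scope.

(* [pzRingType] is the class of all associative unital rings, the zero ring   *)
(* included: being nonzero is part of [is_domain], not of being a ring.       *)

Section Factorizations.
Variable R : pzRingType.

Definition is_domain : Prop :=
  (1 != 0 :> R) /\ forall a b : R, a * b = 0 -> a = 0 \/ b = 0.

(* [unitRingType] would require an inverse operation as extra structure.      *)
Definition is_unit (a : R) : Prop := exists b : R, b * a = 1 /\ a * b = 1.

Definition cancellative (a : R) : Prop := GRing.lreg a /\ GRing.rreg a.

Definition is_atom (u : R) : Prop :=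
  [/\ cancellative u, ~ is_unit u &
      forall a b : R, cancellative a -> cancellative b -> u = a * b ->
        is_unit a \/ is_unit b].

Definition is_factorization (a : R) (us : seq R) : Prop :=
  {in us, forall u, is_atom u} /\ a = \prod_(u <- us) u.

Definition is_BF_ring : Prop :=
  (forall a : R, cancellative a -> ~ is_unit a ->
     exists us : seq R, is_factorization a us) /\
  (forall a : R, cancellative a ->
     exists lambda : nat, forall us : seq R,
       is_factorization a us -> (size us <= lambda)%N).

Definition is_BF_domain : Prop := is_domain /\ is_BF_ring.

End Factorizations.

Arguments is_domain : clear implicits.
Arguments is_BF_ring : clear implicits.
Arguments is_BF_domain : clear implicits.

(* A [zmodClosed] subgroup has boolean membership; this loses no generality   *)
(* under the classical axioms of [boolp].                                     *)
Record filtration (R : pzRingType) := Filtration {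
  fil :> nat -> zmodClosed R;
  fil_leS : forall i, {subset fil i <= fil i.+1};
  fil_one : 1 \in fil 0;
  fil_mul : forall i j, {in fil i & fil j, forall x y, x * y \in fil (i + j)%N};
  fil_exhaustive : forall x : R, exists i, x \in fil i
}.

Section AssociatedGraded.
Variables (R : pzRingType) (F : filtration R).
Implicit Types (i j n : nat) (x y z : R).

Lemma fil_le i j : (i <= j)%N -> {subset F i <= F j}.
Proof.
move=> /subnKC <-; elim: (j - i)%N => [|k IHk] x; first by rewrite addn0.
by rewrite addnS => /IHk; apply: fil_leS.
Qed.

Definition fil_sub i := {x : R | x \in F i}.
HB.instance Definition _ i := SubChoice.on (fil_sub i).
HB.instance Definition _ i :=
  [SubChoice_isSubZmodule of fil_sub i by <:].

(* R_{i-1}, with R_{-1} = 0; first as a subset of R, then as a subgroup of    *)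
(* R_i                                                                        *)
Definition fil_pred i : {pred R} := if i is j.+1 then F j else pred1 0.

Lemma fil_pred_zmod_closed i : zmod_closed (fil_pred i).
Proof.
case: i => [|i] /=; split; rewrite ?inE ?rpred0 //.
  by move=> x y; rewrite !inE => /eqP-> /eqP->; rewrite subrr.
by move=> x y; apply: rpredB.
Qed.
HB.instance Definition _ i :=
  GRing.isZmodClosed.Build R (fil_pred i) (fil_pred_zmod_closed i).

Definition fil_sub_pred i : {pred fil_sub i} := [pred u | val u \in fil_pred i].
Arguments fil_sub_pred : clear implicits.

Lemma fil_sub_pred_zmod_closed i : zmod_closed (fil_sub_pred i).
Proof.
split=> [|u v]; rewrite !inE ?raddf0 ?rpred0 //.
by rewrite raddfB; apply: rpredB.
Qed.
HB.instance Definition _ i :=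
  GRing.isZmodClosed.Build (fil_sub i) (fil_sub_pred i)
    (fil_sub_pred_zmod_closed i).

(* R_i / R_{i-1} *)
Definition gr_piece i := Quotient.quot (fil_sub_pred i).
HB.instance Definition _ i := GRing.Zmodule.on (gr_piece i).
HB.instance Definition _ i := ZmodQuotient.on (gr_piece i).

(* the class of x in R_i / R_{i-1} when x is in R_i, and 0 otherwise *)
Definition gr_class i x : gr_piece i :=
  \pi_(gr_piece i) (insubd (0 : fil_sub i) x).

Definition gr_lift i (a : gr_piece i) : R := val (repr a).

Lemma gr_lift_fil i (a : gr_piece i) : gr_lift a \in F i.
Proof. exact: valP. Qed.

Lemma gr_liftK i (a : gr_piece i) : gr_class i (gr_lift a) = a.
Proof. by rewrite /gr_class /gr_lift valKd reprK. Qed.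

Lemma gr_class_eq i : {in F i &, forall x y,
  (gr_class i x == gr_class i y) = (x - y \in fil_pred i)}.
Proof.
move=> x y xF yF; rewrite /gr_class -Quotient.idealrBE.
by rewrite inE raddfB /= !val_insubd xF yF.
Qed.

Lemma gr_classB i : {in F i &, {morph gr_class i : x y / x - y}}.
Proof.
move=> x y xF yF; rewrite /gr_class -(raddfB (\pi_(gr_piece i))).
by congr (\pi _); apply: val_inj; rewrite raddfB /= !val_insubd xF yF rpredB.
Qed.

Lemma gr_class0 i : gr_class i 0 = 0.
Proof. by rewrite -(subrr 0) gr_classB ?rpred0 // subrr. Qed.

Lemma gr_classD i : {in F i &, {morph gr_class i : x y / x + y}}.
Proof.
move=> x y xF yF; rewrite -{1}[y]opprK gr_classB ?rpredN //.
by rewrite -[- y]sub0r gr_classB ?rpred0 // gr_class0 sub0r opprK.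
Qed.

Lemma gr_class_sum i (I : finType) (f : I -> R) : (forall k, f k \in F i) ->
  gr_class i (\sum_k f k) = \sum_k gr_class i (f k).
Proof.
move=> fF; pose K x (a : gr_piece i) := x \in F i /\ gr_class i x = a.
have [] // : K (\sum_k f k) (\sum_k gr_class i (f k)).
apply: (big_ind2 K) => [|x a y b [xF <-] [yF <-]|k _]; rewrite /K.
- by rewrite rpred0 gr_class0.
- by rewrite rpredD // gr_classD.
- by rewrite fF.
Qed.

Lemma gr_class_mul i j n x y x' y' : (i + j)%N = n ->
  x \in F i -> x' \in F i -> y \in F j -> y' \in F j ->
  gr_class i x = gr_class i x' -> gr_class j y = gr_class j y' ->
  gr_class n (x * y) = gr_class n (x' * y').
Proof.
move=> <- xF x'F yF y'F /eqP; rewrite gr_class_eq // => dx /eqP.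
rewrite gr_class_eq // => dy; apply/eqP; rewrite gr_class_eq ?fil_mul //.
rewrite -[x * y](subrK (x' * y)) -addrA -mulrBl -mulrBr.
apply: rpredD.
  case: i dx {xF x'F} => [|i] /= dx; last by apply: fil_mul.
  by move: dx; rewrite inE => /eqP->; rewrite mul0r rpred0.
case: j dy {yF y'F} => [|j] /= dy; last by rewrite addnS; apply: fil_mul.
by move: dy; rewrite inE => /eqP->; rewrite mulr0 rpred0.
Qed.

(* gr R, the direct sum of the R_i / R_{i-1}: families of finite support *)
Definition gr_finite_support (f : forall i, gr_piece i) : bool :=
  `[< exists n, forall i, (n <= i)%N -> f i = 0 >].

Record gr := Gr {
  gr_comp : forall i, gr_piece i;
  gr_compP : gr_finite_support gr_comp
}.
HB.instance Definition _ := [isSub for gr_comp].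
HB.instance Definition _ := [Choice of gr by <:].

Lemma gr_eqP (f g : gr) : (forall i, gr_comp f i = gr_comp g i) -> f = g.
Proof. by move=> fg; apply: val_inj; apply: functional_extensionality_dep. Qed.

Lemma gr_supp (f : gr) : exists n, forall i, (n <= i)%N -> gr_comp f i = 0.
Proof. by apply/asboolP; exact: gr_compP. Qed.

Lemma gr_zero_supp : gr_finite_support (fun i => 0 : gr_piece i).
Proof. by apply/asboolP; exists 0%N. Qed.
Definition gr_zero := Gr gr_zero_supp.

Lemma gr_opp_supp (f : gr) : gr_finite_support (fun i => - gr_comp f i).
Proof.
have [n fn] := gr_supp f.
by apply/asboolP; exists n => i /fn->; rewrite oppr0.
Qed.
Definition gr_opp f := Gr (gr_opp_supp f).

Lemma gr_add_supp (f g : gr) :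
  gr_finite_support (fun i => gr_comp f i + gr_comp g i).
Proof.
have [[m fm] [n gn]] := (gr_supp f, gr_supp g).
apply/asboolP; exists (maxn m n) => i; rewrite geq_max => /andP[/fm-> /gn->].
by rewrite addr0.
Qed.
Definition gr_add f g := Gr (gr_add_supp f g).

Lemma gr_addA : associative gr_add.
Proof. by move=> f g h; apply: gr_eqP => i /=; rewrite addrA. Qed.
Lemma gr_addC : commutative gr_add.
Proof. by move=> f g; apply: gr_eqP => i /=; rewrite addrC. Qed.
Lemma gr_add0 : left_id gr_zero gr_add.
Proof. by move=> f; apply: gr_eqP => i /=; rewrite add0r. Qed.
Lemma gr_addN : left_inverse gr_zero gr_opp gr_add.
Proof. by move=> f; apply: gr_eqP => i /=; rewrite addNr. Qed.
HB.instance Definition _ :=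
  GRing.isZmodule.Build gr gr_addA gr_addC gr_add0 gr_addN.

(* (x + R_{i-1})(y + R_{j-1}) = xy + R_{i+j-1}, summed over i + j = n; by     *)
(* [gr_class_mul] the choice of representatives is irrelevant                 *)
Definition gr_mul_comp (f g : forall i, gr_piece i) n : gr_piece n :=
  \sum_(i < n.+1) gr_class n (gr_lift (f i) * gr_lift (g (n - i)%N)).

Lemma gr_mul_compE (f g : forall i, gr_piece i) (x y : nat -> R) :
  (forall i, x i \in F i /\ gr_class i (x i) = f i) ->
  (forall i, y i \in F i /\ gr_class i (y i) = g i) ->
  forall n, let z := \sum_(i < n.+1) x i * y (n - i)%N in
  z \in F n /\ gr_class n z = gr_mul_comp f g n.
Proof.
move=> xf yg n; have xyF (i : 'I_n.+1) : x i * y (n - i)%N \in F n.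
  have := fil_mul (xf i).1 (yg (n - i)%N).1.
  by rewrite subnKC ?leq_ord.
split; first by apply: rpred_sum => i _; apply: xyF.
rewrite gr_class_sum //; apply: eq_bigr => i _.
have [[xF xE] [yF yE]] := (xf i, yg (n - i)%N).
by apply: (gr_class_mul (subnKC (leq_ord i)));
  rewrite ?gr_lift_fil ?gr_liftK.
Qed.

Lemma gr_mul_supp (f g : gr) :
  gr_finite_support (gr_mul_comp (gr_comp f) (gr_comp g)).
Proof.
have [[m fm] [n gn]] := (gr_supp f, gr_supp g).
apply/asboolP; exists (m + n)%N => k le_k; rewrite /gr_mul_comp.
apply: big1 => i _; rewrite -[RHS](gr_class0 k).
have lift0 j : gr_class j (gr_lift (0 : gr_piece j)) = gr_class j 0.
  by rewrite gr_liftK gr_class0.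
have [/fm fi0 | lt_im] := leqP m i.
  rewrite -(mul0r (gr_lift (gr_comp g (k - i)%N))).
  apply: (gr_class_mul (subnKC (leq_ord i)));
    by rewrite ?gr_lift_fil ?rpred0 ?fi0 ?lift0.
have /gn gi0 : (n <= k - i)%N.
  by rewrite leq_subRL ?leq_ord // (leq_trans _ le_k) // leq_add2r ltnW.
rewrite -(mulr0 (gr_lift (gr_comp f i))).
apply: (gr_class_mul (subnKC (leq_ord i)));
  by rewrite ?gr_lift_fil ?rpred0 ?gi0 ?lift0.
Qed.
Definition gr_mul f g := Gr (gr_mul_supp f g).

(* the element x + R_{i-1} of R_i / R_{i-1}, in degree i *)
Definition gr_hom_comp i x j : gr_piece j :=
  if j == i then gr_class j x else 0.

Lemma gr_hom_supp i x : gr_finite_support (gr_hom_comp i x).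
Proof.
apply/asboolP; exists i.+1 => j lt_ij; rewrite /gr_hom_comp.
by case: eqP lt_ij => // ->; rewrite ltnn.
Qed.
Definition gr_hom i x := Gr (gr_hom_supp i x).

Definition gr_one := gr_hom 0 1.

Lemma gr_homP i x : x \in F i -> forall j,
  (if j == i then x else 0) \in F j /\
  gr_class j (if j == i then x else 0) = gr_comp (gr_hom i x) j.
Proof.
move=> xF j; rewrite /= /gr_hom_comp.
by case: eqP => [->|_]; rewrite ?rpred0 ?gr_class0.
Qed.

Lemma gr_liftP (f : gr) i :
  gr_lift (gr_comp f i) \in F i /\
  gr_class i (gr_lift (gr_comp f i)) = gr_comp f i.
Proof. by rewrite gr_lift_fil gr_liftK. Qed.

Lemma gr_mulA : associative gr_mul.
Proof.
move=> f g h; apply: gr_eqP => n.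
have [fP gP hP] := And3 (gr_liftP f) (gr_liftP g) (gr_liftP h).
have fgP := gr_mul_compE fP gP; have ghP := gr_mul_compE gP hP.
rewrite /=; have [_ <-] := gr_mul_compE fP ghP n; have [_ <-] := gr_mul_compE fgP hP n.
congr (gr_class n _).
set p := fun i => gr_lift (gr_comp f i).
set q := fun i => gr_lift (gr_comp g i).
set r := fun i => gr_lift (gr_comp h i).
rewrite -/(p _) -/(q _) -/(r _).
have rev (u v : nat -> R) m : \sum_(i < m.+1) u i * v (m - i)%N =
    \sum_(i < m.+1) u (m - i)%N * v i.
  rewrite (reindex_inj rev_ord_inj) /=.
  by apply: eq_bigr => i _; rewrite subSS (sub_ordK i).
rewrite (rev (fun m => \sum_(i < m.+1) p i * q (m - i)%N) r).
pose c j k := p j * (q (n - j - k)%N * r k).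
transitivity (\sum_(j < n.+1) \sum_(k < n.+1 | (k <= n - j)%N) c j k).
  apply: eq_bigr => /= j _; rewrite (rev q r) big_distrr /=.
  by rewrite (big_ord_narrow_leq (leq_subr _ _)).
rewrite (exchange_big_dep predT) //=; apply: eq_bigr => k _.
transitivity (\sum_(j < n.+1 | (j <= n - k)%N) c j k).
  apply: eq_bigl => j; rewrite -ltnS -(ltnS j) -!subSn ?leq_ord //.
  by rewrite -subn_gt0 -(subn_gt0 j) -!subnDA addnC.
rewrite (big_ord_narrow_leq (leq_subr _ _)) big_distrl /=.
by apply: eq_bigr => j _; rewrite /c -!subnDA addnC mulrA.
Qed.

Lemma gr_mul1 : left_id gr_one gr_mul.
Proof.
move=> f; apply: gr_eqP => n.
have [_ /esym E] := gr_mul_compE (gr_homP (fil_one F)) (gr_liftP f) n.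
apply: etrans E _.
rewrite big_ord_recl /= mul1r subn0 big1 ?addr0 ?gr_liftK //.
by move=> i _; rewrite mul0r.
Qed.

Lemma gr_mulr1 : right_id gr_one gr_mul.
Proof.
move=> f; apply: gr_eqP => n.
have [_ /esym E] := gr_mul_compE (gr_liftP f) (gr_homP (fil_one F)) n.
apply: etrans E _.
rewrite big_ord_recr /= subnn mulr1 big1 ?add0r ?gr_liftK //.
by move=> i _; rewrite subn_eq0 leqNgt ltn_ord mulr0.
Qed.

Lemma gr_addP (f g : gr) i :
  gr_lift (gr_comp f i) + gr_lift (gr_comp g i) \in F i /\
  gr_class i (gr_lift (gr_comp f i) + gr_lift (gr_comp g i))
    = gr_comp (f + g) i.
Proof. by rewrite rpredD ?gr_classD ?gr_lift_fil // !gr_liftK. Qed.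

Lemma gr_mulDl : left_distributive gr_mul +%R.
Proof.
move=> f g h; apply: gr_eqP => n.
have [fP gP hP] := And3 (gr_liftP f) (gr_liftP g) (gr_liftP h).
have [_ /esym E] := gr_mul_compE (gr_addP f g) hP n.
apply: etrans E _.
have [fhF fhE] := gr_mul_compE fP hP n.
have [ghF ghE] := gr_mul_compE gP hP n.
rewrite /= -fhE -ghE -gr_classD // -big_split.
by congr gr_class; apply: eq_bigr => i _; rewrite mulrDl.
Qed.

Lemma gr_mulDr : right_distributive gr_mul +%R.
Proof.
move=> f g h; apply: gr_eqP => n.
have [fP gP hP] := And3 (gr_liftP f) (gr_liftP g) (gr_liftP h).
have [_ /esym E] := gr_mul_compE fP (gr_addP g h) n.
apply: etrans E _.
have [fgF fgE] := gr_mul_compE fP gP n.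
have [fhF fhE] := gr_mul_compE fP hP n.
rewrite /= -fgE -fhE -gr_classD // -big_split.
by congr gr_class; apply: eq_bigr => i _; rewrite mulrDr.
Qed.

HB.instance Definition _ := GRing.Zmodule_isPzRing.Build gr
  gr_mulA gr_mul1 gr_mulr1 gr_mulDl gr_mulDr.

End AssociatedGraded.

(* Main.v *)
Require Import Defs.
From mathcomp Require Import all_boot all_algebra.
From mathcomp Require Import boolp.

Set Implicit Arguments.
Unset Strict Implicit.
Unset Printing Implicit Defensive.

Import GRing.Theory.
Local Open Scope ring_scope.

(** Let the degree of [x] be the least [i] with [x] in the [i]-th step of the
    filtration, so that a nonzero [x] has a nonzero principal symbol
    [gr_hom F (fil_deg F x) x] in the associated graded ring. Symbols multiply
    ([gr_hom_mul]), and over a graded domain a product of nonzero symbols is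
    nonzero; hence [x * y] is nonzero and its degree is exactly the sum of the
    degrees of [x] and [y] ([fil_deg_mul]). In particular the ring is a domain.

    A nonzero element of degree 0 lies in the bottom step, so it is a unit: the
    nonunits among the cancellative elements have positive degree. The degree is
    therefore a length function, and a length function bounds how far a
    cancellative element can be split into nonunits. This both makes the
    splitting stop, which yields factorizations into atoms, and bounds the
    number of atoms by the degree ([length_function_BF]). *)

Section LengthFunctions.
Variable R : pzRingType.

Lemma cancellativeM (a b : R) :
  cancellative a -> cancellative b -> cancellative (a * b).
Proof. by move=> [la ra] [lb rb]; split; [apply: lregM | apply: rregM]. Qed.

Lemma cancellative1 : cancellative (1 : R).
Proof. by split; [apply: lreg1 | apply: rreg1]. Qed.

Lemma cancellative_neq0 (a : R) : 1 != 0 :> R -> cancellative a -> a != 0.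
Proof.
move=> /eqP one_neq0 [la _]; apply/eqP => a0; apply: one_neq0.
by apply: la; rewrite a0 !mul0r.
Qed.

(** A cancellative factor with a cancellative nonunit cofactor is shorter than the
    product, so splitting into nonunits terminates at atoms; and each atom adds
    at least 1 to the length, so a product of [k] atoms has length at least
    [k]. *)
Lemma length_function_BF (len : R -> nat) :
  (forall a b : R, cancellative a -> cancellative b ->
     (len a + len b <= len (a * b)%R)%N) ->
  (forall a : R, cancellative a -> ~ is_unit a -> (0 < len a)%N) ->
  is_BF_ring R.
Proof.
move=> lenM len_gt0; split=> [a | a _].
  have [n] := ubnP (len a); elim: n a => // n IHn a len_a ca Na.
  have [atom_a | not_atom] := pselect (is_atom a).
    exists [:: a]; split; last by rewrite big_seq1.
    by move=> u; rewrite inE => /eqP->.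
  have [b [c [cb cc a_bc Nb Nc]]] : exists b c, [/\ cancellative b,
      cancellative c, a = b * c, ~ is_unit b & ~ is_unit c].
    apply: contra_notP not_atom => no_split; split=> // b c cb cc a_bc.
    have [?|Nb] := pselect (is_unit b); first by left.
    have [?|Nc] := pselect (is_unit c); first by right.
    by case: no_split; exists b, c.
  (* Both factors are nonunits, so each is strictly shorter than [a]. *)
  have := lenM _ _ cb cc; rewrite -a_bc => len_bc.
  have lt_b : (len b < n)%N.
    rewrite -ltnS (leq_trans _ len_a) // ltnS (leq_trans _ len_bc) //.
    by rewrite -addn1 leq_add2l len_gt0.
  have lt_c : (len c < n)%N.
    rewrite -ltnS (leq_trans _ len_a) // ltnS (leq_trans _ len_bc) //.
    by rewrite -add1n leq_add2r len_gt0.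
  have [us [us_atoms b_us]] := IHn b lt_b cb Nb.
  have [vs [vs_atoms c_vs]] := IHn c lt_c cc Nc.
  exists (us ++ vs); split; last by rewrite big_cat -b_us -c_vs.
  by move=> u; rewrite mem_cat => /orP[/us_atoms | /vs_atoms].
exists (len a) => us [us_atoms ->].
(* The lower bound for a product applies to cancellative factors only, so
   cancellativity of the tail product is carried through the induction. *)
suff [] : cancellative (\prod_(u <- us) u) /\
          (size us <= len (\prod_(u <- us) u)%R)%N by [].
elim: us us_atoms => [_|u us IHus us_atoms].
  by rewrite big_nil; split; first exact: cancellative1.
have [cu Nu _] : is_atom u by apply: us_atoms; rewrite mem_head.
have [|cus le_us] := IHus.
  by move=> v vs; apply: us_atoms; rewrite inE vs orbT.
rewrite big_cons; split; first exact: cancellativeM.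
apply: leq_trans (lenM _ _ cu cus).
by rewrite /= -add1n leq_add ?len_gt0.
Qed.

End LengthFunctions.

Section FiltrationDegree.
Variables (R : pzRingType) (F : filtration R).
Implicit Types (i j : nat) (x y : R).

(** The zero element gets degree 0, rather than the usual minus infinity. *)
Definition fil_deg x : nat := ex_minn (fil_exhaustive F x).

Lemma fil_degP x : x \in F (fil_deg x).
Proof. by rewrite /fil_deg; case: ex_minnP. Qed.

Lemma fil_deg_min i x : x \in F i -> (fil_deg x <= i)%N.
Proof. by rewrite /fil_deg; case: ex_minnP => n _; apply. Qed.

Lemma fil_pred_deg x : x != 0 -> x \notin fil_pred F (fil_deg x).
Proof.
move=> x_neq0; apply/negP; case def_d: (fil_deg x) => [|d] /=.
  by rewrite inE (negPf x_neq0).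
by move/fil_deg_min; rewrite def_d ltnn.
Qed.

Lemma gr_hom_eq0 i x : x \in F i -> (gr_hom F i x = 0) <-> (x \in fil_pred F i).
Proof.
move=> xF; have class0 : (gr_class F i x == 0) = (x \in fil_pred F i).
  by rewrite -[0](gr_class0 F i) gr_class_eq ?rpred0 // subr0.
split=> [/(congr1 (fun f => gr_comp f i)) | xP].
  by rewrite /= /gr_hom_comp eqxx => /eqP; rewrite class0.
apply: gr_eqP => j; rewrite /= /gr_hom_comp.
by case: (j =P i) => [->|//]; apply/eqP; rewrite class0.
Qed.

(** A homogeneous element has one nonzero component, so the Cauchy product
    defining the components of the left-hand side has at most one nonzero term,
    the product [x * y] in degree [i + j]. *)
Lemma gr_hom_mul i j x y : x \in F i -> y \in F j ->
  gr_hom F i x * gr_hom F j y = gr_hom F (i + j) (x * y).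
Proof.
move=> xF yF; apply: gr_eqP => n.
have [_ /esym E] := gr_mul_compE (gr_homP xF) (gr_homP yF) n.
apply: etrans E _; have [_ <-] := gr_homP (fil_mul xF yF) n.
congr (gr_class F n _); have [-> | n_neq] := eqVneq n (i + j)%N.
  have lt_i : (i < (i + j).+1)%N by rewrite ltnS leq_addr.
  rewrite (bigD1 (Ordinal lt_i)) //= eqxx addKn eqxx big1 ?addr0 // => k.
  by rewrite -val_eqE /= => /negPf->; rewrite mul0r.
apply: big1 => k _; case: eqP => [k_i | _]; last by rewrite mul0r.
case: eqP => [nk_j | _]; last by rewrite mulr0.
by case/eqP: n_neq; rewrite -k_i -nk_j subnKC // leq_ord.
Qed.

Section GradedDomain.
Hypothesis gr_domain : is_domain (gr F).

Lemma gr_domain_one_neq0 : 1 != 0 :> R.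
Proof.
case: gr_domain => /eqP gr1 _; apply/eqP => one0; apply: gr1.
by apply/(gr_hom_eq0 (fil_one F)); rewrite /= inE one0.
Qed.

(** The product of the two principal symbols is the class of [x * y] in degree
    [fil_deg F x + fil_deg F y], and it is nonzero in the graded domain. As 0
    lies in every [fil_pred], this gives both that [x * y] is nonzero and that
    its degree does not drop. *)
Lemma symbol_mul_neq0 x y : x != 0 -> y != 0 ->
  x * y \notin fil_pred F (fil_deg x + fil_deg y).
Proof.
move=> x_neq0 y_neq0; apply/negP.
move/(gr_hom_eq0 (fil_mul (fil_degP x) (fil_degP y))).
rewrite -gr_hom_mul ?fil_degP // => /(proj2 gr_domain)[].
  by move/(gr_hom_eq0 (fil_degP x)); apply/negP/fil_pred_deg.
by move/(gr_hom_eq0 (fil_degP y)); apply/negP/fil_pred_deg.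
Qed.

Lemma fil_deg_mul x y : x != 0 -> y != 0 ->
  fil_deg (x * y) = (fil_deg x + fil_deg y)%N.
Proof.
move=> x_neq0 y_neq0; apply/eqP; rewrite eqn_leq.
rewrite fil_deg_min ?fil_mul ?fil_degP //= leqNgt; apply/negP => lt_deg.
have /negP[] := symbol_mul_neq0 x_neq0 y_neq0.
case: (fil_deg x + fil_deg y)%N lt_deg => // d /= le_deg.
by apply: (@fil_le _ F _ d le_deg); apply: fil_degP.
Qed.

Lemma gr_domain_is_domain : is_domain R.
Proof.
split=> [|x y xy0]; first exact: gr_domain_one_neq0.
have [|x_neq0] := eqVneq x 0; first by left.
have [|y_neq0] := eqVneq y 0; first by right.
by have := symbol_mul_neq0 x_neq0 y_neq0; rewrite xy0 rpred0.
Qed.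

End GradedDomain.
End FiltrationDegree.

Theorem proposition3p2 (R : pzRingType) (F : filtration R)
    (F0_units : forall x : R, x \in F 0%N -> x != 0 -> is_unit x)
    (gr_domain : is_domain (gr F)) :
  is_BF_domain R.
Proof.
have neq0 := cancellative_neq0 (gr_domain_one_neq0 gr_domain).
split; first exact: gr_domain_is_domain gr_domain.
apply: (@length_function_BF R (fil_deg F)) => [a b ca cb | a ca Na].
  by rewrite fil_deg_mul ?neq0.
rewrite lt0n; apply/eqP => deg0; apply: Na; apply: F0_units; last exact: neq0.
by rewrite -deg0 fil_degP.
Qed.
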